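(* Let $X$ be a metric space with a Borel probability measure $\mu$, let $f:X\to X$ be a measurable map preserving $\mu$, and let $x\in X$ be a point at which the pointwise dimension of $\mu$ exists and equals $d$. Fix $\delta>0$. Then there exists $\varepsilon_0=\varepsilon_0(x,\delta)>0$ such that for all $0<\varepsilon<\varepsilon_0$ and all $N\in\mathbb{N}$, a stationary record $y,f(y),\dots,f^{N-1}(y)$ with $y\sim\mu$ contains an $\varepsilon$-analog of $x$ with probability at most $N\,\varepsilon^{\,d-\delta}$, i.e. $$\mu\big(\{y\in X:\ \exists\,k\in\{0,\dots,N-1\}\text{ with } f^k(y)\in B_\varepsilon(x)\}\big)\le N\,\varepsilon^{\,d-\delta}.$$ Consequently, for such $\varepsilon$, achieving success probability at least $p$ (that is, the record containing an $\varepsilon$-analog of $x$ with probability at least $p$) requires $N\ge p\,\varepsilon^{-(d-\delta)}$.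
   Context: $B_\varepsilon(x)$ is the ball of radius $\varepsilon$ about $x$. The pointwise dimension of $\mu$ at $x$ is $d_\mu(x)=\lim_{\varepsilon\to0}\log\mu(B_\varepsilon(x))/\log\varepsilon$ when this limit exists; here $d$ is a finite real number. An $\varepsilon$-analog of $x$ in a record $y,f(y),\dots,f^{N-1}(y)$ is an entry $f^k(y)$, $0\le k<N$, lying in $B_\varepsilon(x)$. *)

(* Defs.v *)
From HB Require Import structures.
From mathcomp Require Import all_boot all_order all_algebra.
From mathcomp Require Import all_classical all_reals all_analysis.

Set Implicit Arguments.
Unset Strict Implicit.
Unset Printing Implicit Defensive.

Import Order.TTheory GRing.Theory Num.Theory.
Import numFieldTopology.Exports numFieldNormedType.Exports.

Local Open Scope classical_set_scope.
Local Open Scope ring_scope.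

(* Measurable types are pointed in the library, hence the pointed variant of
   [metricType]; the distinguished point plays no role. *)
#[short(type="pmetricType")]
HB.structure Definition PointedMetric (K : numDomainType) :=
  {M of Metric K M & Pointed M}.

Notation borel X := (g_sigma_algebraType (@open X)).

Definition measure_preserving (R : realType) (d : measure_display)
    (T : measurableType d) (mu : {measure set T -> \bar R}) (f : T -> T) : Prop :=
  measurable_fun [set: T] f /\
  forall A : set T, measurable A -> pushforward mu f A = mu A.

(* [lne] is used rather than [ln], since the junk value [ln 0 = 0] would give
   dimension 0 to a point having a null ball, whereas [lne 0 = -oo]. *)
Definition has_pointwise_dimension (R : realType) (X : pmetricType R)
    (mu : probability (borel X) R) (x : X) (d : R) : Prop :=
  (lne (mu (ball x e)) / (ln e)%:E)%E @[e --> 0^'+] --> d%:E.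

Definition analog_event (R : realType) (X : pmetricType R) (f : X -> X) (x : X)
    (eps : R) (N : nat) : set X :=
  [set y | exists2 k : nat, (k < N)%N & ball x eps (iter k f y)].

(* Main.v *)
Require Import Defs.
From HB Require Import structures.
From mathcomp Require Import all_boot all_order all_algebra.
From mathcomp Require Import all_classical all_reals all_analysis.
Import Order.TTheory GRing.Theory Num.Theory.
Import numFieldTopology.Exports numFieldNormedType.Exports.
Local Open Scope classical_set_scope.
Local Open Scope ring_scope.

(** The event that one of [N] stationary observations falls in a set [A] is the
union of the [N] preimages of [A] under the iterates of the dynamics.  Each
preimage has the measure of [A], whatever the dependence between successive
observations, so the union bound gives probability at most [N * mu A]
([measure_hit_le]).

For [A] a ball of radius [eps] about [x], the pointwise dimension enters only
through a lower bound on the quotient [log mu A / log eps]: it eventually exceeds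
[d - delta], and as [log eps < 0], clearing the denominator turns this into the
upper bound [mu A < eps `^ (d - delta)] ([ball_measure_lt]).  The threshold
[eps0] serves every [N] at once, since [N] enters only through the union bound.
The lower bound on [N] is the same inequality divided by [eps `^ (d - delta)]. *)

(** Measurability of balls is what makes the hitting event measurable; it needs
the distance and its triangle inequality, as the balls of a general
pseudometric structure may fail to be open. *)
Lemma metric_ball_open {R : realFieldType} {X : metricType R} (x : X) (r : R) :
  open (ball x r).
Proof.
rewrite openE => y; rewrite ballEmdist/= => xyr.
apply/nbhs_ballP; exists (r - mdist x y) => /=; first by rewrite subr_gt0.
move=> z; rewrite !ballEmdist/= ltrBrDl.
exact/le_lt_trans/metric_triangle.
Qed.

Lemma measurable_metric_ball {R : realFieldType} {X : pmetricType R} (x : X)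
    (r : R) : measurable (ball x r : set (borel X)).
Proof. by apply: sub_sigma_algebra; exact: metric_ball_open. Qed.

Lemma measurable_fun_iter {d : measure_display} {T : measurableType d}
    {f : T -> T} (k : nat) :
  measurable_fun [set: T] f -> measurable_fun [set: T] (iter k f).
Proof.
move=> mf; elim: k => [|k ih]; first exact: measurable_id.
exact: (measurableT_comp mf ih).
Qed.

Lemma measure_preserving_iter {R : realType} {d : measure_display}
    {T : measurableType d} {mu : {measure set T -> \bar R}} {f : T -> T}
    (k : nat) :
  measure_preserving mu f -> measure_preserving mu (iter k f).
Proof.
move=> [mf muf]; split; first exact: measurable_fun_iter.
elim: k => [//|k ih] A mA.
have mfA : measurable (f @^-1` A) by rewrite -[X in measurable X]setTI; exact: mf.
exact: etrans (ih _ mfA) (muf _ mA).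
Qed.

(** Union bound over the first [N] times: stationarity makes every term of the
sum equal to [mu A]. *)
Lemma measure_hit_le {R : realType} {d : measure_display}
    {T : measurableType d} {mu : {measure set T -> \bar R}} {f : T -> T}
    {A : set T} (N : nat) :
  measure_preserving mu f -> measurable A ->
  (mu [set y | exists2 k, (k < N)%N & A (iter k f y)] <= N%:R%:E * mu A)%E.
Proof.
move=> pf mA; rewrite (_ : [set _ | _] = \big[setU/set0]_(k < N) (iter k f @^-1` A)).
  apply: le_trans.
    apply: (@Boole_inequality _ _ _ mu (fun k => iter k f @^-1` A)) => k _.
    have [mfk _] := measure_preserving_iter k pf.
    by rewrite -[X in measurable X]setTI; exact: mfk.
  rewrite /= (eq_bigr (fun=> mu A)) => [|k _].
    by rewrite sumr_const card_ord mule_natl.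
  by have [_ muk] := measure_preserving_iter k pf; exact: muk.
by rewrite -(bigcup_mkord N (fun k => iter k f @^-1` A)).
Qed.

(** As [ln e < 0], a large quotient [lne m / ln e] means a small [m].  The
inequality survives for [m = 0], where [lne m = -oo] makes the quotient [+oo]. *)
Lemma lt_powR_of_lne_div {R : realType} {m : \bar R} {e c : R} :
  (0 <= m)%E -> 0 < e < 1 ->
  (c%:E < lne m / (ln e)%:E)%E -> (m < (e `^ c)%:E)%E.
Proof.
move=> m0 e01; have /andP[e0 _] := e01.
have lne0 := ln_lt0 e01.
rewrite inver lt_eqF// lte_ndivlMr// -EFinM => lnem_lt.
rewrite -[m]lneK ?in_itv/= ?m0 ?leey//.
by rewrite /powR gt_eqF// -[_%:E]/(expeR (c * ln e)%:E) lte_expeR.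
Qed.

Lemma ball_measure_lt {R : realType} {X : pmetricType R}
    {mu : probability (borel X) R} {x : X} {d c : R} :
  has_pointwise_dimension mu x d -> c < d ->
  \forall e \near 0^'+, (mu (ball x e) < (e `^ c)%:E)%E.
Proof.
move=> dim cd.
have quot_gt : \forall e \near 0^'+, (c%:E < lne (mu (ball x e)) / (ln e)%:E)%E.
  apply: (dim [set q | (c%:E < q)%E]); apply: open_nbhs_nbhs; split; first exact: open_ereal_gt_ereal.
  by rewrite /= lte_fin.
near=> e; apply: lt_powR_of_lne_div; first exact: measure_ge0.
  apply/andP; split; near: e; first exact: nbhs_right_gt.
  exact: nbhs_right_lt.
by near: e.
Unshelve. all: by end_near. Qed.

Theorem proposition1 (R : realType) (X : pmetricType R)
    (mu : probability (borel X) R) (f : borel X -> borel X) (x : X)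
    (d delta : R) :
  measure_preserving mu f ->
  has_pointwise_dimension mu x d ->
  0 < delta ->
  exists2 eps0 : R, 0 < eps0 &
    forall (eps : R) (N : nat), 0 < eps < eps0 ->
      (mu (analog_event f x eps N) <= (N%:R * eps `^ (d - delta))%:E)%E /\
      (forall p : R, (p%:E <= mu (analog_event f x eps N))%E ->
         p * eps `^ (- (d - delta)) <= N%:R).
Proof.
move=> pf dim delta0.
have [|eps0 /= eps0_gt0 small] := ball_measure_lt (c := d - delta) dim.
  by rewrite ltrBlDr ltrDl.
exists eps0 => // eps N /andP[e0 e_lt].
have muB : (mu (ball x eps) < (eps `^ (d - delta))%:E)%E.
  by apply: small => //=; rewrite sub0r normrN gtr0_norm.
have bound : (mu (analog_event f x eps N) <= (N%:R * eps `^ (d - delta))%:E)%E.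
  apply: le_trans (measure_hit_le N pf (measurable_metric_ball x eps)) _.
  by rewrite EFinM lee_wpmul2l// ltW.
split=> // p /le_trans/(_ bound); rewrite lee_fin => p_le.
by rewrite powRN ler_pdivrMr// powR_gt0.
Qed.
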